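(* Let $\mathcal P$ be a collection of probability measures on a measurable space $(\Omega,\mathcal F)$, and let $(X_n)_{n=1}^\infty$ be random variables on $(\Omega,\mathcal F)$ that are independent and identically distributed under every $P\in\mathcal P$; write $X$ for a generic copy of $X_1$. Suppose that for some $\delta\in(0,2)$, $$\lim_{m\to\infty}\sup_{P\in\mathcal P}\mathbb E_P\left(|X-\mathbb E_P(X)|^{2+\delta}\,\mathbf 1\{|X-\mathbb E_P(X)|^{2+\delta}>m\}\right)=0.$$ Let $\widehat\sigma_n^2$ be the sample variance. Then for every $\varepsilon>0$, $$\lim_{m\to\infty}\sup_{P\in\mathcal P}P\left(\sup_{k\ge m}\left\{\frac{\left|\widehat\sigma_k^2-\mathrm{Var}_P(X)\right|}{k^{2/(2+\delta)-1}}\right\}\ge\varepsilon\right)=0.$$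
   Context: $\mathbb E_P$ and $\mathrm{Var}_P$ denote expectation and variance under $P$; it is understood that $\mathbb E_P(X)$ is well defined and finite for every $P\in\mathcal P$. The sample variance is $\widehat\sigma_n^2:=\frac1n\sum_{i=1}^n(X_i-\overline X_n)^2$, where $\overline X_n:=\frac1n\sum_{i=1}^nX_i$. *)

(* Defs.v *)
From HB Require Import structures.
From mathcomp Require Import all_boot all_order all_algebra finmap.
From mathcomp Require Import all_classical all_reals all_analysis.

Set Implicit Arguments.
Unset Strict Implicit.
Unset Printing Implicit Defensive.

Import Order.TTheory GRing.Theory Num.Theory.
Import numFieldNormedType.Exports.

Local Open Scope classical_set_scope.
Local Open Scope ring_scope.

(* Mutual independence under P: the product rule for every finite subfamily. *)
Definition independent_RVs d (T : measurableType d) (R : realType)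
    (P : probability T R) (I : choiceType) (X : I -> {mfun T >-> R}) : Prop :=
  forall (J : {fset I}) (B : I -> set R),
    (forall i, i \in J -> measurable (B i)) ->
    P (\bigcap_(i in [set` J]) X i @^-1` B i) =
      (\prod_(i <- J) P (X i @^-1` B i))%E.

(* Equality of laws is required on Borel sets only, since a measure is
   represented by a function on all sets. *)
Definition identically_distributed d (T : measurableType d) (R : realType)
    (P : probability T R) (I : Type) (X : I -> {mfun T >-> R}) : Prop :=
  forall (i j : I) (B : set R), measurable B ->
    distribution P (X i) B = distribution P (X j) B.

(* A sequence is indexed from 0: the first n variables are X 0, ..., X n.-1. *)
Definition sample_mean (T : Type) (R : realType) (X : nat -> T -> R)
    (n : nat) (w : T) : R :=
  (\sum_(i < n) X i w) / n%:R.

Definition sample_variance (T : Type) (R : realType) (X : nat -> T -> R)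
    (n : nat) (w : T) : R :=
  (\sum_(i < n) (X i w - sample_mean X n w) ^+ 2) / n%:R.

(* |X - E_P(X)|^p, for integrable X (so that fine returns the mean itself). *)
Definition central_absolute_power d (T : measurableType d) (R : realType)
    (P : probability T R) (X : T -> R) (p : R) (w : T) : R :=
  `|X w - fine 'E_P[X]| `^ p.

(* Main.v *)
Require Import Defs.
From HB Require Import structures.
From mathcomp Require Import all_boot all_order all_algebra finmap.
From mathcomp Require Import all_classical all_reals all_analysis.
From mathcomp Require Import measurable_realfun ring lra.

(** The sample variance is an average of squares minus a squared average: with
    c = E_P(X), v = Var_P(X), Y_i = (X_i - c)^2 and xi_i = X_i - c,
      sigma_k^2 - v = (1/k) sum_(i<k) (Y_i - v) - ((1/k) sum_(i<k) xi_i)^2.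
    Write p = 2 + delta.  Divided by k^(2/p - 1), the deviation exceeds eps/2
    only if k^(-2/p) |sum (Y_i - v)| >= eps/4 or
    k^(-1/2 - 1/p) |sum xi_i| >= sqrt (eps/4)
    (sample_variance_deviation).  Both are handled by one statement, a strong law
    of Marcinkiewicz-Zygmund type that is uniform over the family of probability
    measures (uniform_marcinkiewicz_zygmund): for i.i.d. Z_i and 1 < r < 2, if
    |Z|^r is uniformly integrable, then the probability that
    |sum_(i<k) (Z_i - E Z)| >= eps k^(1/r) for some k >= m tends to 0 uniformly.
    It applies to Y with r = p/2, where |Y|^r = |X - c|^p, and to xi with
    r = 2p/(p+2), an exponent smaller than p for which
    1/r = 1/2 + 1/p.

    The uniform law follows from a bound under a single measure
    (marcinkiewicz_zygmund_tail).  Cut the times into dyadic blocks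
    2^j <= k < 2^(j+1), and in block j truncate every Z_i at |Z_i|^r <= 2^j.
    The probability that some truncation is active is at most
    2^(j+1) P(|Z|^r > 2^j); recentring costs a bias which is small against
    2^(j/r) because it is controlled by E(|Z|^r; |Z|^r > 2^j); and the truncated
    centred walk is controlled by Kolmogorov's maximal inequality, with variance
    at most 2^(j+1) E(Z^2; |Z|^r <= 2^j).  Summing over the blocks j >= J under
    the expectation, the first and third terms are geometric sums, dominated
    pointwise by a multiple of |Z|^r 1{|Z|^r > M} + M (M / 2^J)^(2/r - 1) as soon
    as M <= 2^J (dyadic_sum_le).  Uniform integrability makes the first summand
    small through the choice of M, and then J large makes the second one small.

    Kolmogorov's inequality (kolmogorov_inequality) is obtained from the walk
    stopped when it first leaves ]-lam, lam[: its increments are orthogonal, since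
    each of them is a function of the past times an independent centred variable
    (integral_past_mul_centered), so that its second moment is at most the sum of
    the second moments of the steps. *)

Set Implicit Arguments.
Unset Strict Implicit.
Unset Printing Implicit Defensive.

Import Order.TTheory GRing.Theory Num.Theory.
Import numFieldNormedType.Exports.

Local Open Scope classical_set_scope.
Local Open Scope ring_scope.

(** * Independence from the past *)

Section past.
Context d (T : measurableType d) (R : realType).
Variable X : nat -> {mfun T >-> R}.

Definition cylinder (n : nat) : set (set T) :=
  [set A | exists2 B : nat -> set R, (forall l, measurable (B l)) &
    A = \bigcap_(l in [set l | (l < n)%N]) X l @^-1` B l].

(** The space T with the sigma-algebra of X 0, ..., X n.-1. *)
Definition past (n : nat) : measurableType (sigma_display (cylinder n)) :=
  g_sigma_algebraType (cylinder n).

Lemma setI_closed_cylinder n : setI_closed (cylinder n).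
Proof.
move=> _ _ [B mB ->] [C mC ->]; exists (fun l => B l `&` C l).
  by move=> l; exact: measurableI.
rewrite -bigcapI; apply: eq_bigcapr => l _.
by rewrite preimage_setI.
Qed.

Lemma measurable_cylinder n : cylinder n `<=` measurable.
Proof.
move=> _ [B mB ->]; rewrite bigcap_mkcond; apply: bigcapT_measurable => l.
by case: ifP => // _; exact: measurable_funPTI.
Qed.

Lemma measurable_past n (A : set T) :
  (cylinder n).-sigma.-measurable A -> measurable A.
Proof.
apply: smallest_sub; last exact: measurable_cylinder.
exact: sigma_algebra_measurable.
Qed.

Lemma measurable_past_fun n (g : T -> R) :
  measurable_fun [set: past n] (g : past n -> R) -> measurable_fun [set: T] g.
Proof.
move=> mg _ B mB; apply: measurable_past.
exact: (mg measurableT B mB).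
Qed.

Lemma measurable_fun_past n l : (l < n)%N ->
  measurable_fun [set: past n] (X l : past n -> R).
Proof.
move=> ln _ B mB; rewrite setTI; apply: sub_gen_smallest.
exists (fun j => if j == l then B else setT).
  by move=> j; case: ifP.
apply/seteqP; split => [w Bw j jn /=|w /(_ l ln)/=]; last by rewrite eqxx.
by case: ifPn => // /eqP ->.
Qed.

Variable P : probability T R.
Hypothesis indX : independent_RVs P X.

Lemma probability_cylinder n (B : nat -> set R) :
  (forall l, measurable (B l)) ->
  P (\bigcap_(l in [set l | (l < n)%N]) X l @^-1` B l) =
  (\prod_(0 <= l < n) P (X l @^-1` B l))%E.
Proof.
move=> mB; pose J := seq_fset tt (iota 0 n).
have -> : \bigcap_(l in [set l | (l < n)%N]) X l @^-1` B l =
    \bigcap_(l in [set` J]) X l @^-1` B l.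
  by apply: eq_bigcapl; split => l /=;
    rewrite seq_fsetE mem_iota.
rewrite indX// /index_iota subn0; apply: perm_big.
by rewrite (perm_trans (seq_fset_perm _ _))// undup_id// iota_uniq.
Qed.

(** Independence is given for finite families of events; it reaches the whole
    sigma-algebra of the past because cylinders are stable under intersection,
    by Dynkin's pi-lambda theorem. *)
Lemma past_indep n (A : set T) (C : set R) :
  (cylinder n).-sigma.-measurable A -> measurable C ->
  P (A `&` X n @^-1` C) = (P A * P (X n @^-1` C))%E.
Proof.
move=> + mC; pose D := X n @^-1` C.
have mD : measurable D by exact: measurable_funPTI.
have indepC (S : set T) : measurable S -> P (S `&` D) = (P S * P D)%E ->
    P (~` S `&` D) = (P (~` S) * P D)%E.
  move=> mS PS; have -> : ~` S `&` D = D `\` (S `&` D).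
    by rewrite setDIr setDv setU0 setDE setIC.
  rewrite measureD//; last 2 first.
    exact: measurableI.
    by rewrite (le_lt_trans (probability_le1 _ _)) ?ltry.
  rewrite [X in (_ - X)%E](_ : _ = P S * P D)%E; last first.
    by rewrite -PS; congr (P _); rewrite setIC -setIA setIid.
  rewrite probability_setC//.
  by rewrite muleBl ?mul1e ?fin_num_adde_defr ?fin_num_measure.
have indepU (F : (set T)^nat) : (forall k, measurable (F k)) ->
    trivIset setT F -> (forall k, P (F k `&` D) = (P (F k) * P D)%E) ->
    P ((\bigcup_k F k) `&` D) = (P (\bigcup_k F k) * P D)%E.
  move=> mF tF PF; rewrite setI_bigcupl measure_bigcup//=; last 2 first.
    by move=> k _; exact: measurableI.
    exact: trivIset_setIr.
  rewrite measure_bigcup//= muleC.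
  rewrite -[P D]fineK ?fin_num_measure// -nneseriesZl//.
  apply: eq_eseriesr => k _.
  by rewrite fineK ?fin_num_measure// muleC; exact: PF.
apply: (@dynkin_induction _ (past n) (cylinder n)
    (fun A => P (A `&` D) = (P A * P D)%E)) => //.
- exact: setI_closed_cylinder.
- by rewrite setTI probability_setT mul1e.
- move=> _ [B mB ->].
  pose B' l := if l == n then C else B l.
  have eB l : (l < n)%N -> B' l = B l by rewrite /B'; case: ltngtP.
  have -> : \bigcap_(l in [set l | (l < n)%N]) X l @^-1` B l `&` D =
      \bigcap_(l in [set l | (l < n.+1)%N]) X l @^-1` B' l.
    apply/seteqP; split => [w [/= Bw Dw] l /=|w Bw].
      rewrite ltnS leq_eqVlt => /predU1P[->|ln]; first by rewrite /B' eqxx.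
      by rewrite eB//; exact: Bw.
    split => [l /= ln|]; first by rewrite -eB//; apply: Bw => /=; rewrite leqW.
    by have := Bw n (ltnSn n); rewrite /B' eqxx.
  rewrite !probability_cylinder//; last by move=> l; rewrite /B'; case: ifP.
  rewrite big_nat_recr//= {2}/B' eqxx; congr (_ * _)%E.
  by apply: eq_big_nat => l ln; rewrite eB.
- by move=> S /measurable_past; exact: indepC.
- by move=> F mF tF; apply: indepU => // k; exact: measurable_past (mF k).
Qed.

(** The identity, seen as a random variable with values in the coarser space: its
    law is the restriction of P to the past. *)
Definition pastproj n (w : T) : past n := w.

Lemma measurable_pastproj n : measurable_fun [set: T] (@pastproj n).
Proof. by move=> _ A mA; rewrite setTI; exact: measurable_past mA. Qed.

(** Independence makes the joint law of the past and X n a product measure, so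
    Fubini's theorem integrates the centred factor h (X n) first. *)
Lemma integral_past_mul_centered n (g : T -> R) (h : R -> R) :
  measurable_fun [set: past n] (g : past n -> R) ->
  measurable_fun [set: R] h ->
  P.-integrable [set: T] (fun w => (h (X n w))%:E) ->
  P.-integrable [set: T] (fun w => (g w * h (X n w))%:E) ->
  (\int[P]_w (h (X n w))%:E = 0 ->
  \int[P]_w (g w * h (X n w))%:E = 0)%E.
Proof.
move=> mg mh ih igh Eh.
pose F w : past n * R := (pastproj n w, X n w).
have mF : measurable_fun [set: T] F.
  by apply: measurable_fun_pair => //; exact: measurable_pastproj.
pose pp := mfun_Sub (mem_set (@measurable_pastproj n) : (@pastproj n) \in mfun).
pose FF := mfun_Sub (mem_set mF : F \in mfun).
pose G (z : past n * R) := (g z.1 * h z.2)%:E.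
have mG : measurable_fun setT G.
  apply/measurable_EFinP/measurable_funM.
    by apply: measurableT_comp.
  by apply: measurableT_comp.
have prodE A : measurable A ->
    (distribution P pp \x distribution P (X n))%E A = distribution P FF A.
  move=> mA; apply: product_measure_unique => // B C mB mC.
  by rewrite /distribution /pushforward -past_indep.
have iG : (distribution P FF).-integrable setT G.
  exact: integrable_pushforward.
transitivity (\int[distribution P FF]_z G z)%E.
  by rewrite integral_pushforward.
pose m2 := distribution P (X n).
pose m1 := distribution P pp.
transitivity (\int[(m1 \x m2)%E]_z G z)%E.
  by apply: eq_measure_integral => A mA _; apply/esym; exact: prodE.
have iG' : (m1 \x m2)%E.-integrable setT G.
  case/integrableP : iG => _ iG; apply/integrableP; split => //.
  rewrite (eq_measure_integral (distribution P FF))// => A mA _.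
  exact: prodE.
rewrite -integral12_prod_meas1//.
apply: integral0_eq => x _ /=.
transitivity (\int[m2]_y ((g x)%:E * (h y)%:E))%E.
  by apply: eq_integral => y _; rewrite -EFinM.
rewrite integralZl//; last first.
  by apply: integrable_pushforward => //; exact/measurable_EFinP.
rewrite integral_distribution//; last exact/measurable_EFinP.
by rewrite Eh mule0.
Qed.
End past.

(** * Kolmogorov's maximal inequality *)

Section level_sets.
Context d (T : measurableType d) (R : realType).
Implicit Types f g : T -> R.

Lemma measurable_set_le f g : measurable_fun [set: T] f ->
  measurable_fun [set: T] g -> measurable [set w | f w <= g w].
Proof.
by move=> mf mg; rewrite -[X in measurable X]setTI; exact: measurable_fun_le.
Qed.

Lemma measurable_set_lt f g : measurable_fun [set: T] f ->
  measurable_fun [set: T] g -> measurable [set w | f w < g w].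
Proof.
move=> mf mg; rewrite (_ : [set _ | _] = ~` [set w | g w <= f w]).
  by apply: measurableC; exact: measurable_set_le.
by apply/seteqP; split => w /=; rewrite ltNge => /negP.
Qed.

Lemma measurable_some_large (D : set nat) (b : nat -> R) (S : nat -> T -> R) :
  (forall k, measurable_fun [set: T] (S k)) ->
  measurable [set w | exists2 k, D k & b k <= `|S k w|].
Proof.
move=> mS.
rewrite (_ : [set _ | _] = \bigcup_(k in D) [set w | b k <= `|S k w|]).
  apply: bigcup_measurable => k _.
  by apply: measurable_set_le => //; exact: measurableT_comp.
by apply/seteqP; split => w [k]; exists k.
Qed.

End level_sets.

Lemma bounded_integrable d (T : measurableType d) (R : realType)
    (P : probability T R) (f : T -> R) (c : R) :
  measurable_fun [set: T] f -> (forall w, `|f w| <= c) ->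
  P.-integrable [set: T] (EFin \o f).
Proof.
move=> mf fc; apply: measurable_bounded_integrable => //.
  by rewrite (le_lt_trans (probability_le1 _ _)) ?ltry.
by exists c; split; [exact: num_real|move=> y cy w _; exact: le_trans (ltW cy)].
Qed.

Lemma second_moment_markov d (T : measurableType d) (R : realType)
    (P : probability T R) (f : T -> R) (a : R) :
  measurable_fun [set: T] f -> 0 <= a ->
  ((a ^+ 2)%:E * P [set w | (a <= `|f w|)%R] <= \int[P]_w (f w ^+ 2)%:E)%E.
Proof.
move=> mf a0.
have mA : measurable [set w | (a <= `|f w|)%R].
  by apply: measurable_set_le => //; exact: measurableT_comp.
have mf2 : measurable_fun setT (fun w => (f w ^+ 2)%:E).
  by apply/measurable_EFinP; exact: measurable_funX.
rewrite -integral_cst//.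
apply: (@le_trans _ _
    (\int[P]_(w in [set w | (a <= `|f w|)%R]) (f w ^+ 2)%:E)%E).
  apply: ge0_le_integral => //.
  - by move=> w _; rewrite lee_fin sqr_ge0.
  - exact: measurable_funTS.
  - move=> w /= aw; rewrite lee_fin -(real_normK (num_real (f w))).
    by rewrite lerXn2r// nnegrE.
apply: ge0_subset_integral => //.
by move=> w _; rewrite lee_fin sqr_ge0.
Qed.

Section kolmogorov.
Context d (T : measurableType d) (R : realType) (P : probability T R).
Variables (X : nat -> {mfun T >-> R}) (h : nat -> R -> R) (c lam : R).
Hypothesis indX : independent_RVs P X.
Hypothesis mh : forall i, measurable_fun [set: R] (h i).
Hypothesis h_le : forall i x, `|h i x| <= c.
Hypothesis h_centered : (forall i, \int[P]_w (h i (X i w))%:E = 0)%E.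
Hypothesis lam_ge0 : 0 <= lam.

Let xi i w := h i (X i w).

Let S k w := \sum_(i < k) xi i w.

(* The gate of the stopped walk: open while the position is in ]-lam, lam[. *)
Let u (x : R) : R := \1_[set x : R | `|x| < lam] x.

(** Freezing on the current position rather than on a running maximum keeps the
    definition recursive: once outside ]-lam, lam[ the walk never moves again. *)
Fixpoint stopped_walk k w : R :=
  if k is k'.+1 then stopped_walk k' w + u (stopped_walk k' w) * xi k' w else 0.

Let u_le1 x : `|u x| <= 1.
Proof. by rewrite /u indicE; case: (_ \in _); rewrite ?normr1 ?normr0. Qed.

Let measurable_u : measurable_fun [set: R] u.
Proof.
apply: measurable_indic.
by apply: measurable_set_lt.
Qed.

Let mxi i : measurable_fun [set: T] (xi i).
Proof. exact: measurableT_comp. Qed.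

Lemma stopped_walk_past k n : (k <= n)%N ->
  measurable_fun [set: past X n] (stopped_walk k : past X n -> R).
Proof.
elim: k => [_|k IH kn] /=; first exact: measurable_cst.
apply: measurable_funD; first by apply: IH; exact: ltnW.
apply: measurable_funM.
  by apply: (measurableT_comp measurable_u); apply: IH; exact: ltnW.
by apply: (measurableT_comp (mh k)); exact: measurable_fun_past.
Qed.

Lemma measurable_stopped_walk k : measurable_fun [set: T] (stopped_walk k).
Proof.
by apply: (@measurable_past_fun _ _ _ X k); exact: stopped_walk_past.
Qed.

Lemma stopped_walk_le k w : `|stopped_walk k w| <= k%:R * c.
Proof.
elim: k => [|k IH] /=; first by rewrite normr0 mul0r.
rewrite -natr1 mulrDl mul1r (le_trans (ler_normD _ _))// lerD//.
by rewrite normrM -[leRHS]mul1r ler_pM ?u_le1//; exact: h_le.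
Qed.

(** Until it freezes the stopped walk is the walk S itself, so S can only become
    large after the stopped walk has done so, and the latter stays large. *)
Lemma stopped_walk_max n w : (exists2 k, (k <= n)%N & lam <= `|S k w|) ->
  lam <= `|stopped_walk n w|.
Proof.
have frozen j m : lam <= `|stopped_walk j w| -> lam <= `|stopped_walk (j + m) w|.
  move=> lj; elim: m => [|m IH]; first by rewrite addn0.
  rewrite addnS /= /u indicE memNset ?mul0r ?addr0//=.
  by apply/negP; rewrite -leNgt.
have walk k : stopped_walk k w = S k w \/ lam <= `|stopped_walk k w|.
  elim: k => [|k [IH|IH]] /=; first by left; rewrite /S big_ord0.
    have [lw|wl] := leP lam `|stopped_walk k w|.
      by right; have := frozen k 1 lw; rewrite addn1.
    by left; rewrite {1}/u indicE mem_set// mul1r IH /S big_ord_recr.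
  by right; have := frozen k 1 IH; rewrite addn1.
move=> [k kn lk]; rewrite -(subnKC kn); apply: frozen.
by case: (walk k) => // ->.
Qed.

(** In the square of position + gate * step, the cross term is a function of the
    past times the centred step, hence has mean 0, and the gate is at most 1. *)
Lemma stopped_walk_second_moment n :
  (\int[P]_w (stopped_walk n w ^+ 2)%:E <=
   \sum_(i < n) \int[P]_w (xi i w ^+ 2)%:E)%E.
Proof.
elim: n => [|n IH].
  by rewrite big_ord0 /= integral0_eq// => w _; rewrite expr0n.
rewrite big_ord_recr /=; apply: le_trans (leeD2r _ IH).
pose g w := 2 * (stopped_walk n w * u (stopped_walk n w)).
have mW := measurable_stopped_walk n.
have mg : measurable_fun [set: past X n] (g : past X n -> R).
  apply: measurable_funM => //; apply: measurable_funM.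
    exact: stopped_walk_past.
  by apply: (measurableT_comp measurable_u); exact: stopped_walk_past.
have g_le w : `|g w| <= 2 * (n%:R * c).
  rewrite normrM gtr0_norm// ler_pM2l// normrM -[leRHS]mulr1.
  by rewrite ler_pM ?u_le1//; exact: stopped_walk_le.
have ixi : P.-integrable setT (EFin \o xi n).
  by apply: (@bounded_integrable _ _ _ _ _ c) => // w; exact: h_le.
have iW : P.-integrable setT (EFin \o (fun w => stopped_walk n w ^+ 2)).
  apply: (@bounded_integrable _ _ _ _ _ ((n%:R * c) ^+ 2)) => [|w].
    exact: measurable_funX.
  rewrite normrX lerXn2r ?nnegrE ?stopped_walk_le//.
  exact: le_trans (stopped_walk_le n w).
have igxi : P.-integrable setT (EFin \o (fun w => g w * xi n w)).
  apply: (@bounded_integrable _ _ _ _ _ (2 * (n%:R * c) * c)) => [|w].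
    by apply: measurable_funM => //; exact: measurable_past_fun mg.
  by rewrite normrM ler_pM//; exact: h_le.
have ixi2 : P.-integrable setT (EFin \o (fun w => xi n w ^+ 2)).
  apply: (@bounded_integrable _ _ _ _ _ (c ^+ 2)) => [|w].
    exact: measurable_funX.
  by rewrite normrX lerXn2r ?nnegrE ?h_le ?(le_trans _ (h_le n 0)).
have -> : (\int[P]_w (stopped_walk n w ^+ 2)%:E + \int[P]_w (xi n w ^+ 2)%:E =
    \int[P]_w ((stopped_walk n w ^+ 2)%:E + (g w * xi n w)%:E +
      (xi n w ^+ 2)%:E))%E.
  rewrite integralD//; last exact: integrableD.
  rewrite integralD//; congr (_ + _)%E; rewrite -[LHS]adde0; congr (_ + _)%E.
  by rewrite (@integral_past_mul_centered _ _ _ X).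
apply: ge0_le_integral => //.
- by move=> w _; rewrite lee_fin sqr_ge0.
- apply/measurable_EFinP/measurable_funX => /=.
  exact: (measurable_stopped_walk n.+1).
- by apply: emeasurable_funD; [apply: emeasurable_funD|];
    apply/measurable_EFinP; apply/measurable_EFinP;
    [move/measurable_int : iW|move/measurable_int : igxi|
     move/measurable_int : ixi2].
move=> w _; rewrite -!EFinD lee_fin /g.
have : 0 <= (1 - u (stopped_walk n w) ^+ 2) * xi n w ^+ 2.
  apply: mulr_ge0; last exact: sqr_ge0.
  by rewrite subr_ge0 -(real_normK (num_real (u _))) expr_le1.
by rewrite !sqrrD; lra.
Qed.

Theorem kolmogorov_inequality n :
  ((lam ^+ 2)%:E * P [set w | exists2 k, (k <= n)%N & (lam <= `|S k w|)%R] <=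
   \sum_(i < n) \int[P]_w (h i (X i w) ^+ 2)%:E)%E.
Proof.
have mS k : measurable_fun [set: T] (S k) by exact: measurable_sum.
apply: le_trans (stopped_walk_second_moment n).
have mW := measurable_stopped_walk n.
apply: le_trans (second_moment_markov P mW lam_ge0).
rewrite lee_pmul ?lee_fin ?sqr_ge0//; apply: le_measure => //.
- by rewrite inE; exact: measurable_some_large.
- rewrite inE.
  by apply: measurable_set_le => //; exact: measurableT_comp.
- exact: stopped_walk_max.
Qed.

End kolmogorov.

(** * Dyadic sums *)

Section capped_sums.
Context (R : realType).
Implicit Types rho c y : R.

(** Discarding the terms of a geometric sequence that exceed 1 leaves a sum that
    starts at a term at most 1. *)
Lemma sum_geometric_capped rho c n : 0 <= rho < 1 -> 0 <= c ->
  \sum_(i < n) c * rho ^+ i * (c * rho ^+ i <= 1)%R%:R <=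
    Num.min c 1 / (1 - rho).
Proof.
move=> /andP[rho0 rho1]; have rho1' : 0 < 1 - rho by rewrite subr_gt0.
elim: n c => [|n IH] c c0.
  by rewrite big_ord0 divr_ge0 ?le_min ?c0 ?ler01 ?ltW.
rewrite big_ord_recl expr0 mulr1.
under eq_bigr => i _ do rewrite /= /bump /= add1n exprS mulrA.
have := IH (c * rho) (mulr_ge0 c0 rho0).
rewrite !ler_pdivlMr// => h; rewrite mulrDl.
have [c1|c1] := leP c 1.
  have : Num.min (c * rho) 1 <= c * rho by rewrite ge_min lexx.
  by rewrite mulr1; nra.
by rewrite mulr0 mul0r add0r (le_trans h)// ge_min lexx orbT.
Qed.

Lemma sum_dyadic_capped y J n : 0 <= y ->
  \sum_(i < n) 2 ^+ (J + i) * (2 ^+ (J + i) < y)%R%:R <= 2 * y.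
Proof.
(* Up to the last power of 2 below y the sum is bounded by the next power of 2;
   afterwards it no longer grows. *)
move=> y0; set s := \sum_(i < n) _.
suff : s <= 2 * y /\ s <= 2 ^+ (J + n) by case.
rewrite /s {s}; elim: n => [|n [IHy IH]].
  by rewrite big_ord0 mulr_ge0// exprn_ge0.
rewrite big_ord_recr /= addnS exprS; have [yn|yn] := ltP (2 ^+ (J + n)) y.
  by split; rewrite mulr1; lra.
rewrite mulr0 addr0; split=> //.
by rewrite (le_trans IH)// ler_peMl ?exprn_ge0// ler1n.
Qed.

End capped_sums.

Section dyadic_pointwise.
Context (R : realType).
Variables (r : R).
Hypotheses (r_gt1 : 1 < r) (r_lt2 : r < 2).

Let r0 : 0 < r. Proof. exact: lt_trans r_gt1. Qed.

(** The level in block j: |z| `^ r <= 2 ^+ j means |z| <= dyadic_scale j. *)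
Definition dyadic_scale (j : nat) : R := (2 ^+ j) `^ r^-1.

Let theta := 2 / r - 1.

Let rho : R := 2^-1 `^ theta.

Lemma dyadic_scale_gt0 j : 0 < dyadic_scale j.
Proof. by rewrite powR_gt0// exprn_gt0. Qed.

Let theta_gt0 : 0 < theta.
Proof. by rewrite subr_gt0 ltr_pdivlMr// mul1r. Qed.

Lemma decay_ratio_bounds : 0 <= rho < 1.
Proof.
rewrite powR_ge0 /=; apply: (@lt_le_trans _ _ (1 `^ theta)).
  by rewrite gt0_ltr_powR// ?nnegrE ?invr_ge0// invf_lt1// ltr1n.
by rewrite powR1.
Qed.

Lemma powR_invrK z : 0 <= z -> (z `^ r) `^ r^-1 = z.
Proof. by move=> z0; rewrite -powRrM mulfV ?gt_eqF// powRr1. Qed.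

(** The variance of the truncated walk in block j, relative to the square of the
    scale, gains the factor (|z|^r / 2^j)^theta over |z|^r. *)
Lemma dyadic_scaled_square z j : 0 <= z ->
  2 ^+ j * (z ^+ 2 / dyadic_scale j ^+ 2) =
    z `^ r * (z `^ r / 2 ^+ j) `^ theta.
Proof.
move=> z0; have j0 : (0 : R) < 2 ^+ j by rewrite exprn_gt0.
have t0 : 0 <= z `^ r / 2 ^+ j by rewrite divr_ge0 ?powR_ge0 ?ltW.
have -> : z ^+ 2 / dyadic_scale j ^+ 2 = (z `^ r / 2 ^+ j) `^ (2 / r).
  rewrite [2 / r]mulrC powRrM -[(dyadic_scale j ^+ 2)^-1]exprVn -exprMn.
  rewrite powRM ?powR_ge0 ?invr_ge0 ?ltW//.
  rewrite powR_invrK// /dyadic_scale -powR_inv1 ?powR_ge0// -powRrM mulrN1.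
  rewrite -[(2 ^+ j)^-1]powR_inv1 ?ltW// -powRrM mulN1r.
  by rewrite powR_mulrn// mulr_ge0 ?powR_ge0.
rewrite -mulr_powRB1 ?divr_gt0// mulrA; congr (_ * _).
by rewrite mulrC divfK ?gt_eqF.
Qed.

Lemma dyadic_ratio y J i : 0 <= y ->
  (y / 2 ^+ (J + i)) `^ theta = (y / 2 ^+ J) `^ theta * rho ^+ i.
Proof.
move=> y0; rewrite exprD invfM mulrA powRM ?divr_ge0 ?exprn_ge0//.
congr (_ * _).
by rewrite /rho -exprVn -powR_mulrn ?invr_ge0// powRAC powR_mulrn ?powR_ge0.
Qed.

(** Pointwise domination of the sum over all blocks from J on of the exceedance
    term and of the variance term.  Where |z|^r > M both capped sums are at most a
    multiple of |z|^r.  Where |z|^r <= M <= 2^J there is no exceedance, and the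
    variance terms form a geometric sequence of first term |z|^r (|z|^r / 2^J)^theta,
    at most M (M / 2^J)^theta. *)
Lemma dyadic_sum_le z L M J n : 0 <= z -> 0 <= L -> 0 <= M -> M <= 2 ^+ J ->
  \sum_(i < n) (2 ^+ (J + i).+1 * (2 ^+ (J + i) < z `^ r)%R%:R +
    L * 2 ^+ (J + i).+1 *
      ((z * (z `^ r <= 2 ^+ (J + i))%R%:R) ^+ 2 / dyadic_scale (J + i) ^+ 2)) <=
  4 * (z `^ r * (M < z `^ r)%R%:R) + 2 * L / (1 - rho) *
    (z `^ r * (M < z `^ r)%R%:R + M * (M / 2 ^+ J) `^ theta).
Proof.
move=> z0 L0 M0 MJ; set y := z `^ r; have y0 : 0 <= y by exact: powR_ge0.
have [rho0 rho1] := andP decay_ratio_bounds.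
rewrite big_split /=; apply: lerD.
  under eq_bigr do rewrite exprS -mulrA; rewrite -mulr_sumr.
  have [My|yM] := ltP M y.
    by rewrite mulr1; have := sum_dyadic_capped J n y0; lra.
  rewrite big1 ?mulr0// => i _.
  rewrite ltNge (le_trans yM (le_trans MJ _)) ?mulr0//.
  by rewrite ler_weXn2l ?ler1n// leq_addr.
pose c := (y / 2 ^+ J) `^ theta.
have c0 : 0 <= c by exact: powR_ge0.
apply: (@le_trans _ _ (\sum_(i < n) 2 * L * y *
    (c * rho ^+ i * (c * rho ^+ i <= 1)%R%:R))).
  apply: ler_sum => i _.
  have [yi|_] := leP y (2 ^+ (J + i)); last first.
    by rewrite mulr0 expr0n/= mul0r mulr0 !mulr_ge0// exprn_ge0.
  have c1 : c * rho ^+ i <= 1.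
    have e1 : 1 `^ theta = 1 by rewrite powR1.
    rewrite -dyadic_ratio// -[leRHS]e1 ge0_ler_powR ?(ltW theta_gt0) ?nnegrE//.
      by rewrite divr_ge0// exprn_ge0.
    by rewrite ler_pdivrMr ?exprn_gt0// mul1r.
  rewrite c1 !mulr1 exprS -dyadic_ratio// -mulrA.
  have := dyadic_scaled_square (J + i) z0; rewrite -/y => e.
  rewrite -[2 * L * y * _]mulrA -e.
  by rewrite le_eqVlt; apply/orP; left; apply/eqP; ring.
rewrite -mulr_sumr.
have := sum_geometric_capped n decay_ratio_bounds c0 => hs.
apply: (@le_trans _ _ (2 * L * y * (Num.min c 1 / (1 - rho)))).
  by rewrite ler_wpM2l// !mulr_ge0.
rewrite [leLHS](_ : _ = 2 * L / (1 - rho) * (y * Num.min c 1)); last by ring.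
apply: ler_wpM2l; first by rewrite !mulr_ge0// invr_ge0 subr_ge0 ltW.
have [My|yM] := ltP M y.
  rewrite mulr1 (@le_trans _ _ (y * 1)) ?mulr1 ?lerDl ?mulr_ge0 ?powR_ge0//.
  by rewrite -[leRHS]mulr1 ler_wpM2l// ge_min lexx orbT.
rewrite mulr0 add0r ler_pM ?le_min ?c0 ?ler01//.
rewrite (@le_trans _ _ c) ?ge_min ?lexx// /c.
rewrite ge0_ler_powR ?(ltW theta_gt0)// ?nnegrE.
- by rewrite divr_ge0// exprn_ge0.
- by rewrite divr_ge0// exprn_ge0.
- by rewrite ler_wpM2r// invr_ge0 exprn_ge0.
Qed.

(** Beyond the truncation level, |z| is at most dyadic_scale j * |z|^r / 2^j since
    r >= 1; this bounds the bias created by the truncation. *)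
Lemma dyadic_tail_le z j : 0 <= z ->
  2 ^+ j * (z * (2 ^+ j < z `^ r)%R%:R) <=
    dyadic_scale j * (z `^ r * (2 ^+ j < z `^ r)%R%:R).
Proof.
move=> z0; have j0 : (0 : R) < 2 ^+ j by rewrite exprn_gt0.
have [jz|_] := ltP (2 ^+ j) (z `^ r); last by rewrite !mulr0.
rewrite !mulr1 -{1}(powR_invrK z0) /dyadic_scale.
have y0 : 0 < z `^ r by exact: lt_trans jz.
have E t : 0 < t -> t = t `^ r^-1 * t `^ (1 - r^-1).
  by move=> t0; rewrite -powRD ?subrKC ?powRr1 ?ltW ?gt_eqF ?implybT.
rewrite [X in X * _ <= _](E _ j0) [X in _ <= _ * X](E _ y0).
rewrite -mulrA ler_wpM2l ?powR_ge0// mulrC ler_wpM2l ?powR_ge0//.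
rewrite ge0_ler_powR ?nnegrE ?(ltW j0) ?(ltW y0) ?(ltW jz)//.
by rewrite subr_ge0 invf_le1 ?(ltW r_gt1).
Qed.

Lemma dyadic_trunc_le z j : 0 <= z ->
  z * (z `^ r <= 2 ^+ j)%R%:R <= dyadic_scale j.
Proof.
move=> z0; have [zj|_] := leP (z `^ r) (2 ^+ j); last first.
  by rewrite mulr0 ltW// dyadic_scale_gt0.
rewrite mulr1 -{1}(powR_invrK z0) ge0_ler_powR ?nnegrE ?powR_ge0 ?exprn_ge0//.
by rewrite invr_ge0 ltW.
Qed.

End dyadic_pointwise.

(** * Moments and identical laws *)

Section moments.
Context d (T : measurableType d) (R : realType) (P : probability T R).

Lemma integral_centered (f : T -> R) : P.-integrable [set: T] (EFin \o f) ->
  (\int[P]_w (f w - \int[P]_t f t)%:E = 0)%E.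
Proof.
move=> fi; under eq_integral do rewrite EFinB.
rewrite integralB_EFin//; last exact: finite_measure_integrable_cst.
rewrite integral_cst//= probability_setT mule1 /Rintegral fineK ?subee//.
all: exact: integrable_fin_num.
Qed.

Lemma variance_le_second_moment (f : T -> R) (c : R) :
  measurable_fun [set: T] f -> (forall w, `|f w| <= c) ->
  (\int[P]_w ((f w - \int[P]_t f t) ^+ 2)%:E <= \int[P]_w (f w ^+ 2)%:E)%E.
Proof.
move=> mf fc; set m := (\int[P]_t f t)%R.
have fi := bounded_integrable P mf fc.
have mg : measurable_fun setT (fun w => f w - m) by exact: measurable_funB.
have gc w : `|f w - m| <= c + `|m|.
  by rewrite (le_trans (ler_normB _ _))// lerD2r.
have gi := bounded_integrable P mg gc.
have g2i : P.-integrable setT (EFin \o (fun w => (f w - m) ^+ 2)).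
  apply: (@bounded_integrable _ _ _ _ _ ((c + `|m|) ^+ 2)) => [|w].
    exact: measurable_funX.
  by rewrite normrX lerXn2r ?nnegrE ?gc// (le_trans _ (gc w)).
have mi : P.-integrable setT (cst (m ^+ 2)%:E).
  exact: finite_measure_integrable_cst.
have gmi : P.-integrable setT (fun w => ((2 * m)%:E * (f w - m)%:E)%E).
  exact: integrableZl.
have -> : (\int[P]_w (f w ^+ 2)%:E = \int[P]_w (((f w - m) ^+ 2)%:E +
    ((2 * m)%:E * (f w - m)%:E + (m ^+ 2)%:E)))%E.
  apply: eq_integral => w _; rewrite -EFinM -!EFinD; congr EFin; ring.
rewrite integralD//; last exact: integrableD.
rewrite integralD// integralZl// integral_centered// mule0 add0e leeDl//.
by apply: integral_ge0 => w _; rewrite lee_fin sqr_ge0.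
Qed.

End moments.

Section identical.
Context d (T : measurableType d) (R : realType) (P : probability T R).
Variables (X : nat -> {mfun T >-> R}).
Hypothesis idX : identically_distributed P X.

Lemma identical_probability i (B : set R) : measurable B ->
  P (X i @^-1` B) = P (X 0%N @^-1` B).
Proof. exact: idX. Qed.

Lemma ge0_identical_integral i (f : R -> \bar R) : measurable_fun [set: R] f ->
  (forall x, 0 <= f x)%E -> (\int[P]_w f (X i w) = \int[P]_w f (X 0%N w))%E.
Proof.
move=> mf f0; rewrite -!(@ge0_integral_distribution _ _ _ _ _ P _ f)//.
by apply: eq_measure_integral => A mA _; exact: idX.
Qed.

Lemma identical_integral i (f : R -> \bar R) : measurable_fun [set: R] f ->
  (\int[P]_w f (X i w) = \int[P]_w f (X 0%N w))%E.
Proof.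
move=> mf; rewrite [LHS]integralE [RHS]integralE.
congr (_ - _)%E.
  under eq_integral do rewrite (@funepos_comp _ _ _ f (X i)).
  under [RHS]eq_integral do rewrite (@funepos_comp _ _ _ f (X 0%N)).
  by apply: ge0_identical_integral => //; exact: measurable_funepos.
under eq_integral do rewrite (@funeneg_comp _ _ _ f (X i)).
under [RHS]eq_integral do rewrite (@funeneg_comp _ _ _ f (X 0%N)).
by apply: ge0_identical_integral => //; exact: measurable_funeneg.
Qed.

End identical.

Lemma measurable_bool_indic d (T : measurableType d) (R : realType)
    (p : T -> bool) : measurable [set w | p w] ->
  measurable_fun [set: T] (fun w => (p w)%:R : R).
Proof.
move=> mp; rewrite (_ : (fun _ => _) = \1_[set w | p w]).
  exact: measurable_indic.
by apply/funext => w; rewrite indicE; case: (boolP (p w)) => pw;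
  [rewrite mem_set|rewrite memNset//; apply/negP].
Qed.

Lemma esum_ord_const (R : realType) n (x : \bar R) :
  (\sum_(i < n) x = n%:R%:E * x)%E.
Proof.
elim: n => [|n IH]; first by rewrite big_ord0 mul0e.
by rewrite big_ord_recr /= IH -natr1 EFinD ge0_muleDl ?lee_fin// mul1e.
Qed.

(** * A maximal tail bound under one probability measure *)

Section dyadic_blocks.
Context d (T : measurableType d) (R : realType) (P : probability T R).
Variables (X : nat -> {mfun T >-> R}) (h : R -> R) (r eps a M : R) (J : nat).
Hypotheses (indX : independent_RVs P X) (idX : identically_distributed P X).
Hypothesis mh : measurable_fun [set: R] h.
Hypotheses (r_gt1 : 1 < r) (r_lt2 : r < 2).
Hypotheses (eps_gt0 : 0 < eps) (M_ge0 : 0 <= M) (MJ : M <= 2 ^+ J).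

Let y x := `|h x| `^ r.

Hypothesis tail_le :
  (\int[P]_w (y (X 0%N w) * (M < y (X 0%N w))%R%:R)%:E <= a%:E)%E.
(* Keeps the bias of the truncation below half of the threshold in every block. *)
Hypothesis a_le : 4 * a <= eps.

Let mu := (\int[P]_w h (X 0%N w))%R.

Let S k w := \sum_(i < k) (h (X i w) - mu).

Let trunc j x := h x * (y x <= 2 ^+ j)%R%:R.

Let tail j x := h x * (2 ^+ j < y x)%R%:R.

Let m j := (\int[P]_w trunc j (X 0%N w))%R.

Let my : measurable_fun [set: R] y.
Proof.
by apply: (measurableT_comp (measurable_powR r)); exact: measurableT_comp.
Qed.

Let mlt t : measurable_fun [set: R] (fun x => (t < y x)%R%:R : R).
Proof. by apply: measurable_bool_indic; exact: measurable_set_lt. Qed.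

Let mtrunc j : measurable_fun [set: R] (trunc j).
Proof.
apply: measurable_funM => //.
by apply: measurable_bool_indic; exact: measurable_set_le.
Qed.

Let mtail j : measurable_fun [set: R] (tail j).
Proof. exact: measurable_funM. Qed.

Let trunc_le j x : `|trunc j x| <= dyadic_scale r j.
Proof.
rewrite normrM (ger0_norm (ler0n _ _)).
exact: dyadic_trunc_le.
Qed.

Let tail_ge0 t x : 0 <= y x * (t < y x)%R%:R.
Proof. by rewrite mulr_ge0// powR_ge0. Qed.

Let tail_mono t x : M <= t -> y x * (t < y x)%R%:R <= y x * (M < y x)%R%:R.
Proof.
move=> Mt; rewrite ler_wpM2l ?powR_ge0// ler_nat.
by have [ty|_] := ltP t (y x); rewrite ?(le_lt_trans Mt ty).
Qed.

Let tail_integrable : P.-integrable [set: T]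
  (fun w => (y (X 0%N w) * (M < y (X 0%N w))%R%:R)%:E).
Proof.
apply/integrableP; split.
  apply/measurable_EFinP; apply: measurable_funM.
    exact: measurableT_comp.
  by apply: (measurableT_comp (mlt M)).
under eq_integral do rewrite gee0_abs ?lee_fin//.
by rewrite (le_lt_trans tail_le)// ltry.
Qed.

Let trunc_integrable j : P.-integrable [set: T] (EFin \o (trunc j \o X 0%N)).
Proof.
by apply: bounded_integrable => [|w]; [exact: measurableT_comp|exact: trunc_le].
Qed.

Let truncDtail j x : trunc j x + tail j x = h x.
Proof.
by rewrite /trunc /tail -mulrDr; case: leP => _; rewrite ?addr0 ?add0r mulr1.
Qed.

Let scaled_tail_le j x : (J <= j)%N ->
  2 ^+ j * `|tail j x| <= dyadic_scale r j * (y x * (M < y x)%R%:R).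
Proof.
move=> Jj; rewrite normrM (ger0_norm (ler0n _ _)).
apply: (le_trans (dyadic_tail_le r_gt1 j (normr_ge0 (h x)))).
rewrite ler_wpM2l ?(ltW (dyadic_scale_gt0 _ _))//; apply: tail_mono.
rewrite (le_trans MJ)//.
by rewrite ler_weXn2l ?ler1n.
Qed.

Let tailj_integrable j : (J <= j)%N ->
  P.-integrable [set: T] (EFin \o (tail j \o X 0%N)).
Proof.
move=> Jj.
have := integrableZl measurableT (dyadic_scale r j) tail_integrable.
apply: le_integrable => //.
  by apply/measurable_EFinP; exact: measurableT_comp.
move=> w _ /=; rewrite lee_fin [leRHS]ger0_norm ?mulr_ge0 ?powR_ge0//.
apply: le_trans (scaled_tail_le _ Jj).
by rewrite ler_peMl// exprn_ege1// ler1n.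
Qed.

(* The truncation shifts the mean by the expectation of the tail. *)
Let bias_le j : (J <= j)%N -> 2 ^+ j * `|mu - m j| <= dyadic_scale r j * a.
Proof.
move=> Jj; have ti := tailj_integrable Jj.
have -> : mu - m j = (\int[P]_w tail j (X 0%N w))%R.
  apply: (canLR (addrK _)); rewrite addrC.
  rewrite -(RintegralD measurableT (trunc_integrable j) ti).
  by apply: eq_Rintegral => w _ /=; rewrite truncDtail.
rewrite -lee_fin EFinM.
apply: (@le_trans _ _ ((2 ^+ j)%:E * \int[P]_w (`|tail j (X 0%N w)|)%:E)%E).
  rewrite lee_wpmul2l// ?lee_fin ?exprn_ge0// EFin_normr_Rintegral//.
  by apply: le_abse_integral => //; exact: (measurable_int P ti).
have mat : measurable_fun setT (fun w => `|tail j (X 0%N w)|%:E).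
  apply/measurable_EFinP; apply: measurableT_comp => //.
  exact: measurableT_comp.
rewrite -ge0_integralZl_EFin// ?exprn_ge0//.
apply: (@le_trans _ _ (\int[P]_w ((dyadic_scale r j)%:E *
    (y (X 0%N w) * (M < y (X 0%N w))%R%:R)%:E))%E).
  apply: ge0_le_integral => //.
  - exact: measurable_funeM.
  - by apply: measurable_funeM; exact: (measurable_int P tail_integrable).
  - by move=> w _; rewrite -!EFinM lee_fin; exact: scaled_tail_le.
rewrite ge0_integralZl_EFin ?(ltW (dyadic_scale_gt0 _ _))//.
- by rewrite EFinM lee_wpmul2l// lee_fin ltW// dyadic_scale_gt0.
- by move=> w _; rewrite lee_fin.
- exact: (measurable_int P tail_integrable).
Qed.

Let block j := [set w | exists2 k, (2 ^ j <= k < 2 ^ j.+1)%N &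
  eps * k%:R `^ r^-1 <= `|S k w|].

Let exceed j i := [set w | 2 ^+ j < y (X i w)].

Let walk j k w := \sum_(i < k) (trunc j (X i w) - m j).

Let walk_large j := [set w | exists2 k, (k <= 2 ^ j.+1)%N &
  eps / 2 * dyadic_scale r j <= `|walk j k w|].

(* Without exceedance the walk is the truncated centred walk up to a drift of k
   times the bias, and k < 2 * 2^j turns bias_le into a drift of at most
   eps / 2 * dyadic_scale r j. *)
Let block_sub j : (J <= j)%N ->
  block j `<=` \big[setU/set0]_(i < 2 ^ j.+1) exceed j i `|` walk_large j.
Proof.
move=> Jj w [k /andP[jk kj] kS].
have [[i [ij iy]]|noexceed] :=
    pselect (exists i, (i < 2 ^ j.+1)%N /\ 2 ^+ j < y (X i w)).
  by left; rewrite -(bigcup_mkord _ (exceed j)); exists i.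
right; exists k; first exact: ltnW.
have hE i : (i < k)%N -> h (X i w) = trunc j (X i w).
  move=> ik; rewrite /trunc leNgt; case: ltP => [iy|_]; last by rewrite mulr1.
  by exfalso; apply: noexceed; exists i; split => //; exact: ltn_trans kj.
have SE : S k w = walk j k w - k%:R * (mu - m j).
  rewrite /S /walk mulr_natl -[in X in _ - X](card_ord k) -sumr_const -sumrB.
  by apply: eq_bigr => i _; rewrite hE//; ring.
have k2 : (k%:R : R) <= 2 ^+ j.+1 by rewrite -natrX ler_nat ltnW.
have kb : dyadic_scale r j <= k%:R `^ r^-1.
  rewrite ge0_ler_powR ?nnegrE ?exprn_ge0// ?invr_ge0 ?(ltW (lt_trans _ r_gt1))//.
  by rewrite -natrX ler_nat.
have b0 := dyadic_scale_gt0 r j.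
have bias : k%:R * `|mu - m j| <= eps / 2 * dyadic_scale r j.
  apply: (@le_trans _ _ (2 * (dyadic_scale r j * a))).
    apply: le_trans (ler_wpM2l (ler0n R 2) (bias_le Jj)).
    by rewrite mulrA -exprS ler_wpM2r.
  by move: a_le b0; nra.
have : eps * dyadic_scale r j <= `|walk j k w| + k%:R * `|mu - m j|.
  apply: le_trans (ler_wpM2l (ltW eps_gt0) kb) _; apply: (le_trans kS).
  by rewrite SE (le_trans (ler_normB _ _))// normrM (ger0_norm (ler0n _ _)).
by move: bias; lra.
Qed.

Let mexceed j i : measurable (exceed j i).
Proof. by apply: measurable_set_lt => //; exact: measurableT_comp. Qed.

Let mS k : measurable_fun [set: T] (S k).
Proof.
apply: measurable_sum => i; apply: measurable_funB => //.
exact: measurableT_comp.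
Qed.

Let mwalk j k : measurable_fun [set: T] (walk j k).
Proof.
apply: measurable_sum => i; apply: measurable_funB => //.
exact: measurableT_comp.
Qed.

Let mblock j : measurable (block j).
Proof. exact: measurable_some_large. Qed.

Let mwalk_large j : measurable (walk_large j).
Proof. by apply: measurable_some_large => k; exact: mwalk. Qed.

(* Inverse of the constant in the squared threshold of walk_large. *)
Let L : R := 4 / eps ^+ 2.

Let L_ge0 : 0 <= L. Proof. by rewrite divr_ge0// sqr_ge0. Qed.

Let walk_large_le j : (P (walk_large j) <=
  \int[P]_w (L * 2 ^+ j.+1 *
    (trunc j (X 0%N w) ^+ 2 / dyadic_scale r j ^+ 2))%:E)%E.
Proof.
have b0 := dyadic_scale_gt0 r j.
set lam := eps / 2 * dyadic_scale r j.
have lam0 : 0 < lam by rewrite mulr_gt0// divr_gt0.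
pose g (i : nat) x := trunc j x - m j.
have mg i : measurable_fun [set: R] (g i) by exact: measurable_funB.
have gc i x : `|g i x| <= dyadic_scale r j + `|m j|.
  by rewrite (le_trans (ler_normB _ _))// lerD2r.
have g0 i : (\int[P]_w (g i (X i w))%:E = 0)%E.
  rewrite (identical_integral idX i (f := fun x => (g i x)%:E)); last first.
    exact/measurable_EFinP.
  by rewrite /g /m; exact: (integral_centered (trunc_integrable j)).
have := kolmogorov_inequality indX mg gc g0 (ltW lam0) (2 ^ j.+1).
have mt2 : measurable_fun setT (fun w => (trunc j (X 0%N w) ^+ 2)%:E).
  by apply/measurable_EFinP/measurable_funX; exact: measurableT_comp.
have v (i : 'I_(2 ^ j.+1)) : (\int[P]_w (g i (X i w) ^+ 2)%:E <=
    \int[P]_w (trunc j (X 0%N w) ^+ 2)%:E)%E.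
  rewrite (identical_integral idX i (f := fun x => (g i x ^+ 2)%:E)); last first.
    exact/measurable_EFinP/measurable_funX.
  apply: (@variance_le_second_moment _ _ _ P (trunc j \o X 0%N)) => [|w].
    exact: measurableT_comp.
  exact: trunc_le.
move=> /le_trans/(_ (lee_sum _ (fun i _ => v i))).
rewrite esum_ord_const -lee_pdivlMl ?exprn_gt0//.
move=> /le_trans; apply.
rewrite [leRHS](_ : _ = \int[P]_w ((L * 2 ^+ j.+1 / dyadic_scale r j ^+ 2)%:E *
    (trunc j (X 0%N w) ^+ 2)%:E))%E; last first.
  by apply: eq_integral => w _; rewrite -EFinM; congr EFin; ring.
rewrite ge0_integralZl_EFin//; last 2 first.
- by move=> w _; rewrite lee_fin sqr_ge0.
- by rewrite !mulr_ge0// ?invr_ge0 ?exprn_ge0// ltW.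
rewrite muleA -EFinM le_eqVlt; apply/orP; left; apply/eqP.
congr (_%:E * _)%E; rewrite natrX /lam /L.
by field; rewrite !gt_eqF.
Qed.

(* The probability of block j is at most the expectation of F j (X 0): the first
   term counts exceedances, the second is Kolmogorov's bound. *)
Let F j x := 2 ^+ j.+1 * (2 ^+ j < y x)%R%:R +
  L * 2 ^+ j.+1 * ((`|h x| * (y x <= 2 ^+ j)%R%:R) ^+ 2 / dyadic_scale r j ^+ 2).

Let F_ge0 j x : 0 <= F j x.
Proof.
by rewrite addr_ge0 ?mulr_ge0 ?exprn_ge0 ?invr_ge0 ?sqr_ge0// ltW.
Qed.

Let mF j : measurable_fun [set: R] (F j).
Proof.
apply: measurable_funD; apply: measurable_funM => //.
apply: measurable_funM => //; apply: measurable_funX => //.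
apply: measurable_funM => //; first exact: measurableT_comp.
by apply: measurable_bool_indic; exact: measurable_set_le.
Qed.

Let block_le j : (J <= j)%N -> (P (block j) <= \int[P]_w (F j (X 0%N w))%:E)%E.
Proof.
move=> Jj; have mU : measurable (\big[setU/set0]_(i < 2 ^ j.+1) exceed j i).
  by apply: bigsetU_measurable => i _.
apply: (@le_trans _ _
    (P (\big[setU/set0]_(i < 2 ^ j.+1) exceed j i `|` walk_large j))).
  by apply: le_measure; rewrite ?inE//; [exact: measurableU|exact: block_sub].
apply: (le_trans (measureU2 _ _ _)) => //.
have meX : measurable_fun setT (fun w => (2 ^+ j < y (X 0%N w))%R%:R : R).
  by apply: measurable_bool_indic; exact: mexceed.
rewrite [leRHS](_ : _ = \int[P]_w ((2 ^+ j.+1)%:E *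
    ((2 ^+ j < y (X 0%N w))%R%:R)%:E + (L * 2 ^+ j.+1 *
    (trunc j (X 0%N w) ^+ 2 / dyadic_scale r j ^+ 2))%:E))%E; last first.
  apply: eq_integral => w _; rewrite -EFinM -EFinD; congr EFin.
  by rewrite /F /trunc !exprMn real_normK ?num_real.
rewrite ge0_integralD; last 5 first.
- exact: measurableT.
- by move=> w _; rewrite -EFinM lee_fin mulr_ge0// exprn_ge0.
- by apply: measurable_funeM; exact/measurable_EFinP.
- move=> w _; rewrite lee_fin mulr_ge0//; first by rewrite mulr_ge0// exprn_ge0.
  by rewrite divr_ge0 ?sqr_ge0.
- apply/measurable_EFinP; do 2 apply: measurable_funM => //.
  by apply: measurable_funX; exact: measurableT_comp.
apply: leeD; last exact: walk_large_le.
apply: (le_trans (le_mu_bigsetU _ _)) => //.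
rewrite ge0_integralZl_EFin// ?exprn_ge0//; last exact/measurable_EFinP.
rewrite [X in (_ * X)%E](_ : _ = P (exceed j 0%N)); last first.
  transitivity (\int[P]_w (\1_(exceed j 0%N) w)%:E)%E; last first.
    by rewrite integral_indic// setIT.
  apply: eq_integral => w _; congr EFin; rewrite indicE.
  by case: (boolP (2 ^+ j < y (X 0%N w))) => wy;
    [rewrite mem_set|rewrite memNset//; apply/negP].
rewrite (eq_bigr (fun=> P (exceed j 0%N))) => [|i _].
  by rewrite esum_ord_const natrX.
rewrite /exceed.
apply: (identical_probability idX i (B := [set x | 2 ^+ j < y x])).
exact: measurable_set_lt.
Qed.

Let theta := 2 / r - 1.

Let rho : R := 2^-1 `^ theta.

(** The blocks from J on cover the times k >= 2^J; summing their bounds under the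
    expectation leaves dyadic_sum_le to integrate. *)
Theorem marcinkiewicz_zygmund_tail :
  (P [set w | exists2 k, (2 ^ J <= k)%N & (eps * k%:R `^ r^-1 <= `|S k w|)%R] <=
   (4 * a + 8 / eps ^+ 2 / (1 - rho) * (a + M * (M / 2 ^+ J) `^ theta))%:E)%E.
Proof.
set A := [set w | _]; set C := _%:E.
have mA : measurable A by exact: measurable_some_large.
have AB : A `<=` \bigcup_i block (J + i).
  move=> w [k Jk kS].
  have k0 : (0 < k)%N by rewrite (leq_trans _ Jk)// expn_gt0.
  have /andP[lk kl] := trunc_log_bounds (isT : (1 < 2)%N) k0.
  have Jl : (J <= trunc_log 2 k)%N by rewrite trunc_log_max.
  exists (trunc_log 2 k - J)%N => //; rewrite subnKC//.
  by exists k => //; apply/andP.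
have := @measure_sigma_subadditive _ _ _ P A (fun i => block (J + i))
  (fun i => mblock (J + i)) mA AB.
move=> /le_trans; apply.
apply: lime_le; first by apply: is_cvg_nneseries => *; exact: measure_ge0.
apply: nearW => n; rewrite big_mkord.
apply: (@le_trans _ _ (\sum_(i < n) \int[P]_w (F (J + i) (X 0%N w))%:E)%E).
  by apply: lee_sum => i _; apply: block_le; exact: leq_addr.
have mFX i : measurable_fun setT (fun w => (F (J + i) (X 0%N w))%:E).
  by apply/measurable_EFinP; exact: measurableT_comp.
rewrite -(@ge0_integral_sum _ _ _ P setT measurableT _
  (fun (i : 'I_n) w => (F (J + i) (X 0%N w))%:E))//; last first.
  by move=> i w _; rewrite lee_fin F_ge0.
have rho1 := decay_ratio_bounds r_gt1 r_lt2.
set K := 8 / eps ^+ 2 / (1 - rho).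
have K0 : 0 <= K.
  case/andP: rho1 => _ rho1.
  by rewrite divr_ge0 ?subr_ge0 ?(ltW rho1)// divr_ge0// sqr_ge0.
set q := M * (M / 2 ^+ J) `^ theta.
have q0 : 0 <= q by rewrite mulr_ge0// powR_ge0.
have mt := measurable_int P tail_integrable.
apply: (@le_trans _ _ (\int[P]_w ((4 + K)%:E *
    (y (X 0%N w) * (M < y (X 0%N w))%R%:R)%:E + (K * q)%:E))%E).
  apply: ge0_le_integral => //.
  - by move=> w _; apply: sume_ge0 => i _; rewrite lee_fin F_ge0.
  - exact: emeasurable_sum.
  - by apply: emeasurable_funD => //; exact: measurable_funeM.
  move=> w _; rewrite sumEFin -EFinM -EFinD lee_fin.
  have := dyadic_sum_le r_gt1 r_lt2 n (normr_ge0 (h (X 0%N w))) L_ge0 M_ge0 MJ.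
  move=> /le_trans; apply; rewrite le_eqVlt; apply/orP; left; apply/eqP.
  rewrite /K /q /L /rho /theta /y; ring.
rewrite ge0_integralD; last 5 first.
- exact: measurableT.
- by move=> w _; rewrite -EFinM lee_fin mulr_ge0// addr_ge0.
- exact: measurable_funeM.
- by move=> w _; rewrite lee_fin mulr_ge0.
- exact: measurable_cst.
have -> : (\int[P]_w (K * q)%:E = (K * q)%:E)%E.
  by rewrite (integral_cst P measurableT) /= probability_setT mule1.
rewrite ge0_integralZl_EFin ?addr_ge0//; last first.
  by move=> w _; rewrite lee_fin.
rewrite /C; apply: (@le_trans _ _ ((4 + K)%:E * a%:E + (K * q)%:E)%E).
  by rewrite leeD2r// lee_wpmul2l// lee_fin addr_ge0.
rewrite -EFinM -EFinD lee_fin le_eqVlt; apply/orP; left; apply/eqP.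
by rewrite /K /q; ring.
Qed.

End dyadic_blocks.

(** * The uniform law over a family of probability measures *)

Section uniform.
Context d (T : measurableType d) (R : realType).
Variables (PP : set (probability T R)) (X : nat -> {mfun T >-> R}).
Hypothesis indX : forall P, PP P -> independent_RVs P X.
Hypothesis idX : forall P, PP P -> identically_distributed P X.

(** The function h may depend on the measure, so that it can centre at the mean
    under that measure. *)
Definition uniformly_integrable_power (h : probability T R -> R -> R) (r : R) :=
  forall a : R, 0 < a -> exists n : nat, forall P, PP P ->
    (\int[P]_w (`|h P (X 0%N w)| `^ r *
       (n%:R < `|h P (X 0%N w)| `^ r)%R%:R)%:E <= a%:E)%E.

(** The bound of marcinkiewicz_zygmund_tail depends on the measure only through
    the tail expectation a beyond M: a is made small first, which fixes M, and the
    remaining M (M / 2^J)^theta then vanishes as J grows. *)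
Theorem uniform_marcinkiewicz_zygmund (h : probability T R -> R -> R) (r : R) :
  (forall P, PP P -> measurable_fun [set: R] (h P)) -> 1 < r -> r < 2 ->
  uniformly_integrable_power h r ->
  forall eps eta : R, 0 < eps -> 0 < eta ->
  exists N : nat, forall m, (N <= m)%N -> forall P, PP P ->
  (P [set w | exists2 k, (m <= k)%N & (eps * k%:R `^ r^-1 <=
      `|\sum_(i < k) (h P (X i w) - \int[P]_t h P (X 0%N t))|)%R] <= eta%:E)%E.
Proof.
move=> mh r1 r2 ui eps eta eps0 eta0.
set theta := 2 / r - 1; set rho : R := 2^-1 `^ theta.
have /andP[rho0 rho1] : 0 <= rho < 1 := decay_ratio_bounds r1 r2.
set K := 8 / eps ^+ 2 / (1 - rho).
have K0 : 0 <= K by rewrite divr_ge0 ?subr_ge0 ?(ltW rho1)// divr_ge0// sqr_ge0.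
pose a := Num.min (eps / 4) (eta / 2 / (4 + K)).
have a0 : 0 < a.
  by rewrite lt_min !divr_gt0// ltr_wpDr.
have ae : 4 * a <= eps.
  by rewrite mulrC -ler_pdivlMr// ge_min lexx.
have aK : (4 + K) * a <= eta / 2.
  by rewrite mulrC -ler_pdivlMr ?ltr_wpDr// ge_min lexx orbT.
have [n un] := ui a a0.
have [J [nJ JK]] : exists J, (n <= J)%N /\
    K * (n%:R * (n%:R / 2 ^+ J) `^ theta) <= eta / 2.
  pose A := K * (n%:R * n%:R `^ theta).
  have A0 : 0 <= A by do 2 apply: mulr_ge0 => //.
  have := @cvg_expr R rho; rewrite ger0_norm// => /(_ rho1).
  have e0 : 0 < eta / 2 / (A + 1) by rewrite !divr_gt0// ltr_wpDl.
  move=> /cvgr_lt/(_ _ e0)[J0 _ HJ].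
  exists (maxn J0 n); split; first exact: leq_maxr.
  have := HJ (maxn J0 n) (leq_maxl _ _); rewrite /= ltr_pdivlMr ?ltr_wpDl// => h1.
  have -> : (n%:R / 2 ^+ maxn J0 n) `^ theta = n%:R `^ theta * rho ^+ maxn J0 n.
    by have := @dyadic_ratio R r n%:R 0 (maxn J0 n) (ler0n _ _);
      rewrite add0n expr0 divr1.
  have := exprn_ge0 (maxn J0 n) rho0.
  have -> : K * (n%:R * (n%:R `^ theta * rho ^+ maxn J0 n)) =
      A * rho ^+ maxn J0 n by rewrite /A; ring.
  by lra.
have MJ : n%:R <= 2 ^+ J :> R.
  by rewrite -natrX ler_nat (leq_trans nJ)// ltnW// ltn_expl.
exists (2 ^ J)%N => m Jm P PPP.
have mA l : measurable [set w | exists2 k, (l <= k)%N & eps * k%:R `^ r^-1 <=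
    `|\sum_(i < k) (h P (X i w) - \int[P]_t h P (X 0%N t))|].
  apply: measurable_some_large => k; apply: measurable_sum => i.
  by apply: measurable_funB => //; apply: measurableT_comp => //; exact: mh.
have := marcinkiewicz_zygmund_tail (indX PPP) (idX PPP) (mh _ PPP) r1 r2 eps0
  (ler0n R n) MJ (un _ PPP) ae.
move=> H; apply: le_trans (le_trans _ H) _.
  apply: le_measure; rewrite ?inE//.
  by move=> w [k mk kS]; exists k => //; exact: leq_trans mk.
rewrite lee_fin -/theta -/rho -/K.
by move: aK JK; rewrite mulrDl (mulrDr K); lra.
Qed.

End uniform.

(** |f| <= 1 + |f|^r <= 1 + M + |f|^r 1{|f|^r > M}. *)
Lemma tail_integrable_power d (T : measurableType d) (R : realType)
    (P : probability T R) (f : T -> R) (r M : R) (a : R) :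
  measurable_fun [set: T] f -> 1 <= r -> 0 <= M ->
  (\int[P]_w (`|f w| `^ r * (M < `|f w| `^ r)%R%:R)%:E <= a%:E)%E ->
  P.-integrable [set: T] (EFin \o f).
Proof.
move=> mf r1 M0 fa.
set g := fun w => `|f w| `^ r * (M < `|f w| `^ r)%R%:R.
have g0 w : 0 <= g w by rewrite mulr_ge0// powR_ge0.
have my : measurable_fun [set: T] (fun w => `|f w| `^ r).
  by apply: (measurableT_comp (measurable_powR r)); exact: measurableT_comp.
have mg : measurable_fun [set: T] g.
  apply: measurable_funM => //.
  by apply: measurable_bool_indic; exact: measurable_set_lt.
have gi : P.-integrable [set: T] (EFin \o g).
  apply/integrableP; split; first exact/measurable_EFinP.
  under eq_integral do rewrite gee0_abs ?lee_fin//.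
  by rewrite (le_lt_trans fa)// ltry.
have ci := finite_measure_integrable_cst P (1 + M) measurableT.
apply: le_integrable (integrableD measurableT ci gi) => //.
  exact/measurable_EFinP.
move=> w _ /=; rewrite lee_fin [leRHS]ger0_norm ?addr_ge0//.
have y_le : `|f w| <= 1 + `|f w| `^ r.
  have [f1|f1] := leP 1 `|f w|; last first.
    by rewrite (le_trans (ltW f1))// lerDl powR_ge0.
  by rewrite (le_trans (le1r_powR f1 r1))// lerDr.
rewrite (le_trans y_le)// -addrA lerD2l /g.
by have [My|yM] := ltP M (`|f w| `^ r); rewrite ?mulr1 ?mulr0 ?addr0 ?lerDr.
Qed.

(** * The sample variance *)

Lemma sample_variance_centered (T : Type) (R : realType) (X : nat -> T -> R)
    (c : R) (k : nat) (w : T) : (0 < k)%N ->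
  sample_variance X k w = (\sum_(i < k) (X i w - c) ^+ 2) / k%:R -
    ((\sum_(i < k) (X i w - c)) / k%:R) ^+ 2.
Proof.
move=> k0; have kn0 : (k%:R : R) != 0 by rewrite pnatr_eq0 -lt0n.
set s := \sum_(i < k) (X i w - c).
have me : sample_mean X k w = c + s / k%:R.
  rewrite /sample_mean /s sumrB sumr_const card_ord -mulr_natl.
  by field.
rewrite /sample_variance me.
have -> : \sum_(i < k) (X i w - (c + s / k%:R)) ^+ 2 =
    \sum_(i < k) (X i w - c) ^+ 2 - s ^+ 2 / k%:R.
  transitivity (\sum_(i < k) ((X i w - c) ^+ 2 - 2 * (s / k%:R) * (X i w - c) +
      (s / k%:R) ^+ 2)); first by apply: eq_bigr => i _; ring.
  rewrite big_split /= sumrB -mulr_sumr -/s sumr_const card_ord -mulr_natl.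
  by field.
by field.
Qed.

Section sample_variance_event.
Context d (T : measurableType d) (R : realType).
Variable X : nat -> {mfun T >-> R}.

Lemma measurable_sample_variance k :
  measurable_fun [set: T] (sample_variance X k).
Proof.
have mmean : measurable_fun [set: T] (sample_mean X k).
  by apply: measurable_funM => //; exact: measurable_sum.
apply: measurable_funM => //; apply: measurable_sum => i.
by apply: measurable_funX; exact: measurable_funB.
Qed.

(** A supremum over k >= m of measurable functions is measurable; the division by
    b k is a product by a constant, whatever the value of b k. *)
Lemma measurable_sample_variance_event (e : \bar R) (v : \bar R)
    (b : nat -> R) m :
  measurable [set w | (e <= ereal_sup [set `|(sample_variance X k w)%:E - v| /
    (b k)%:E | k in [set k | (m <= k)%N]])%E].
Proof.
pose g k w := (`|(sample_variance X k w)%:E - v| / (b k)%:E)%E.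
have mg k : measurable_fun [set: T] (g k).
  apply: emeasurable_funM => //; apply: measurableT_comp => //.
  apply: emeasurable_funB => //; apply/measurable_EFinP.
  exact: measurable_sample_variance.
rewrite -[X in measurable X]setTI.
by apply: measurable_lee => //; exact: (measurable_fun_esups mg m).
Qed.

(** Here s stands for 2 / p.  A supremum at least eps has a term above eps / 2,
    where the centred average of squares or the squared average is at least
    eps / 4 * k `^ (s - 1); the square root splits the threshold for the squared
    average, k ^+ 2 * k `^ (s - 1) being the square of k `^ ((1 + s) / 2). *)
Lemma sample_variance_deviation (c v eps s : R) m w : (0 < m)%N -> 0 < eps ->
  0 < s ->
  (eps%:E <= ereal_sup [set `|(sample_variance X k w)%:E - v%:E| /
    (k%:R `^ (s - 1))%R%:E | k in [set k | (m <= k)%N]])%E ->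
  (exists2 k, (m <= k)%N &
    eps / 4 * k%:R `^ s <= `|\sum_(i < k) ((X i w - c) ^+ 2 - v)|) \/
  (exists2 k, (m <= k)%N &
    Num.sqrt (eps / 4) * k%:R `^ ((1 + s) / 2) <= `|\sum_(i < k) (X i w - c)|).
Proof.
move=> m0 eps0 s0 sup_ge.
have eps2 : ((eps / 2)%:E < eps%:E)%E.
  by rewrite lte_fin ltr_pdivrMr// ltr_pMr// ltr1n.
have [_ [k /= mk <-]] := ereal_sup_gt (lt_le_trans eps2 sup_ge).
have k0 : (0 < k)%N := leq_trans m0 mk.
have kR0 : (0 : R) < k%:R by rewrite ltr0n.
set q := k%:R `^ (s - 1); have q0 : 0 < q by exact: powR_gt0.
rewrite inver gt_eqF// -EFinM lte_fin ltr_pdivlMr// => dev.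
have [?|noY] := leP (eps / 4 * k%:R `^ s) `|\sum_(i < k) ((X i w - c) ^+ 2 - v)|.
  by left; exists k.
right; exists k => //; rewrite leNgt; apply/negP => noxi.
set x := \sum_(i < k) (X i w - c) in noxi.
set y := \sum_(i < k) ((X i w - c) ^+ 2 - v) in noY.
have sE : k%:R `^ s = k%:R * q by rewrite /q mulr_powRB1// ltW.
have x2 : x ^+ 2 < eps / 4 * (k%:R ^+ 2 * q).
  have -> : eps / 4 * (k%:R ^+ 2 * q) =
      (Num.sqrt (eps / 4) * k%:R `^ ((1 + s) / 2)) ^+ 2.
    rewrite exprMn sqr_sqrtr ?divr_ge0 ?(ltW eps0)//.
    rewrite -[X in _ = _ * X]powR_mulrn ?powR_ge0// -powRrM divfK ?pnatr_eq0//.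
    rewrite powRD ?(gt_eqF kR0) ?implybT// powRr1 ?(ltW kR0)// sE.
    by ring.
  by rewrite -(real_normK (num_real x)) ltr_pXn2r ?nnegrE.
have svE : sample_variance X k w - v = y / k%:R - (x / k%:R) ^+ 2.
  have yE : y = \sum_(i < k) (X i w - c) ^+ 2 - k%:R * v.
    by rewrite /y sumrB sumr_const card_ord -[in X in _ - X]mulr_natl.
  by rewrite (sample_variance_centered _ c)// -/x yE; field; rewrite gt_eqF.
move: dev; apply/negP; rewrite -leNgt svE.
apply: le_trans (ler_normB _ _) _.
rewrite normrM normfV (ger0_norm (ler0n _ k)) (ger0_norm (sqr_ge0 _)).
have h1 : `|y| / k%:R <= eps / 4 * q.
  rewrite ler_pdivrMr// [leRHS](_ : _ = eps / 4 * k%:R `^ s) ?ltW//.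
  by rewrite sE; ring.
have h2 : (x / k%:R) ^+ 2 <= eps / 4 * q.
  rewrite expr_div_n ler_pdivrMr ?exprn_gt0//.
  rewrite [leRHS](_ : _ = eps / 4 * (k%:R ^+ 2 * q)) ?ltW//.
  by ring.
by move: h1 h2; lra.
Qed.

End sample_variance_event.

Lemma cvge0_of_eventually_le (R : realType) (u : nat -> \bar R) :
  (forall m, 0 <= u m)%E ->
  (forall eta : R, 0 < eta -> exists N, forall m, (N <= m)%N ->
    (u m <= eta%:E)%E) ->
  u @ \oo --> 0%E.
Proof.
move=> u0 uN; have finu (e : R) m : (u m <= e%:E)%E -> u m \is a fin_num.
  by move=> ue; rewrite ge0_fin_numE// (le_lt_trans ue)// ltry.
apply/fine_cvgP; split.
  have [N uN1] := uN 1 ltr01; exists N => // m /= Nm.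
  exact: finu (uN1 m Nm).
apply/cvgrPdist_le => e e0; have [N uNe] := uN e e0; exists N => // m /= Nm.
have ue := uNe m Nm.
rewrite sub0r normrN ger0_norm ?fine_ge0// -lee_fin fineK//.
exact: finu ue.
Qed.

Lemma eventually_lt_of_cvge0 (R : realType) (u : nat -> \bar R) (a : R) :
  u @ \oo --> 0%E -> 0 < a -> exists n, (u n < a%:E)%E.
Proof.
move=> /fine_cvgP[[N1 _ finu] /cvgr_lt cu] a0; have [N2 _ ua] := cu _ a0.
exists (maxn N1 N2); have := ua (maxn N1 N2) (leq_maxr _ _).
by rewrite /= -lte_fin fineK//; apply: finu => /=; exact: leq_maxl.
Qed.

Theorem corollary1 (d : measure_display) (T : measurableType d) (R : realType)
  (PP : set (probability T R)) (X : nat -> {mfun T >-> R}) (delta : R)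
  (Xindep : forall P : probability T R, PP P -> independent_RVs P X)
  (Xident : forall P : probability T R, PP P -> identically_distributed P X)
  (Xint : forall P : probability T R, PP P ->
    P.-integrable [set: T] (EFin \o X 0%N))
  (delta_gt0 : 0 < delta) (delta_lt2 : delta < 2)
  (Xunif :
    ereal_sup [set 'E_P[(fun w =>
        central_absolute_power P (X 0%N) (2 + delta) w *
        \1_[set v | m%:R < central_absolute_power P (X 0%N) (2 + delta) v] w)%R]%E
      | P in PP] @[m --> \oo] --> 0%E)
  (eps : R) (eps_gt0 : 0 < eps) :
  ereal_sup [set P [set w |
      (eps%:E <=
       ereal_sup [set `|(sample_variance X k w)%:E - 'V_P[X 0%N]| /
                      (k%:R `^ (2 / (2 + delta) - 1))%R%:E
                 | k in [set k | (m <= k)%N]])%E]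
    | P in PP] @[m --> \oo] --> 0%E.
Proof.
(* The supremum of the empty set is -oo, which cannot tend to 0. *)
have [P0 PP0] : PP !=set0.
  apply/set0P/eqP => PPe; have /fine_cvgP[[N _ fin] _] := Xunif.
  by have := fin N (leqnn N); rewrite /= PPe image_set0 ereal_sup0.
set p := 2 + delta in Xunif *.
have p2 : 2 < p by rewrite ltrDl.
have p4 : p < 4 by rewrite /p; lra.
have p0 : 0 < p by exact: lt_trans p2.
pose c (P : probability T R) := (\int[P]_w X 0%N w)%R.
have ui a : 0 < a -> exists n : nat, forall P, PP P ->
    (\int[P]_w (`|X 0%N w - c P| `^ p * (n%:R < `|X 0%N w - c P| `^ p)%R%:R)%:E
      <= a%:E)%E.
  move=> /(eventually_lt_of_cvge0 Xunif)[n un]; exists n => P PPP.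
  apply: le_trans (ltW un); apply: ereal_sup_ubound; exists P => //.
  rewrite unlock; apply: eq_integral => w _; congr (_ * _)%:E.
    by rewrite /central_absolute_power unlock.
  rewrite indicE /central_absolute_power unlock -/(c P).
  case: (boolP (n%:R < `|X 0%N w - c P| `^ p)) => nw.
    by rewrite mem_set.
  by rewrite memNset//; apply/negP.
pose sq (P : probability T R) x := (x - c P) ^+ 2.
pose dev (P : probability T R) x := x - c P.
have mdev P : measurable_fun [set: R] (dev P).
  by apply: measurable_funB => //; exact: measurable_id.
have msq P : measurable_fun [set: R] (sq P).
  by apply: measurable_funX; exact: mdev.
have sqE P x : `|sq P x| `^ (p / 2) = `|x - c P| `^ p.
  rewrite /sq normrX -powR_mulrn// -powRrM; congr (_ `^ _).
  by rewrite mulrC divfK.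
have ui_sq : uniformly_integrable_power PP X sq (p / 2).
  move=> a /ui[n un]; exists n => P PPP.
  by under eq_integral do rewrite sqE; exact: un.
have ui_dev : uniformly_integrable_power PP X dev (2 * p / (p + 2)).
  move=> a /ui[n un]; exists n.+1 => P PPP; apply: le_trans (un P PPP).
  have mpow s : measurable_fun [set: T] (fun w => `|X 0%N w - c P| `^ s).
    apply: (measurableT_comp (measurable_powR s)).
    by apply: measurableT_comp => //; exact: measurable_funB.
  have mpi s l : measurable_fun [set: T] (fun w => (`|X 0%N w - c P| `^ s *
      (l < `|X 0%N w - c P| `^ s)%R%:R)%:E).
    apply/measurable_EFinP; apply: measurable_funM => //.
    by apply: measurable_bool_indic; exact: measurable_set_lt.
  apply: ge0_le_integral => //.
  move=> w _; rewrite lee_fin /dev; set z := `|_|.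
  set r := 2 * p / (p + 2).
  have r0 : 0 < r by rewrite divr_gt0 ?mulr_gt0 ?addr_gt0.
  have rp : r <= p by rewrite /r ler_pdivrMr ?addr_gt0//; nra.
  have [nz|_] := ltP n.+1%:R (z `^ r); last by rewrite mulr0 mulr_ge0 ?powR_ge0.
  (* The exponent r is smaller than p, and the level n.+1 forces 1 <= z, where
     powers grow with the exponent. *)
  have z1 : 1 <= z.
    rewrite leNgt; apply/negP => z1; move: nz; apply/negP; rewrite -leNgt.
    apply: (@le_trans _ _ 1); last by rewrite ler1n.
    have e1 : 1 `^ r = 1 by rewrite powR1.
    rewrite -[leRHS]e1.
    by rewrite ge0_ler_powR ?(ltW r0) ?nnegrE ?normr_ge0 ?ler01 ?(ltW z1).
  have zrp : z `^ r <= z `^ p by exact: ler_powR.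
  by rewrite (lt_le_trans (lt_trans _ nz) zrp) ?ltr_nat// !mulr1.
have sq_int P : PP P -> P.-integrable [set: T] (EFin \o (sq P \o X 0%N)).
  move=> PPP; have [n un] := ui_sq 1 ltr01.
  apply: (@tail_integrable_power _ _ _ P _ (p / 2) n%:R 1) => //.
  - exact: measurableT_comp.
  - by rewrite ler_pdivlMr// mul1r ltW.
  - exact: un.
pose v (P : probability T R) := (\int[P]_w sq P (X 0%N w))%R.
have VE P : PP P -> 'V_P[X 0%N]%E = (v P)%:E.
  move=> PPP; rewrite /v /Rintegral fineK; last first.
    exact: integrable_fin_num (sq_int P PPP).
  rewrite /variance covariance.unlock expectation.unlock.
  by apply: eq_integral => w _; rewrite /sq expr2.
have dev0 P : PP P -> (\int[P]_w dev P (X 0%N w))%R = 0.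
  by move=> PPP; rewrite /Rintegral /dev integral_centered//; exact: Xint.
apply: cvge0_of_eventually_le => [m|eta eta0].
  apply: (@le_trans _ _ (P0 [set w | (eps%:E <=
       ereal_sup [set `|(sample_variance X k w)%:E - 'V_P0[X 0%N]| /
                      (k%:R `^ (2 / p - 1))%R%:E
                 | k in [set k | (m <= k)%N]])%E])); first exact: measure_ge0.
  by apply: ereal_sup_ubound; exists P0.
have eta2 : 0 < eta / 2 by rewrite divr_gt0.
have pp2 : 1 < p / 2 by rewrite ltr_pdivlMr// mul1r.
have pp4 : p / 2 < 2 by rewrite ltr_pdivrMr//; lra.
have r1 : 1 < 2 * p / (p + 2) by rewrite ltr_pdivlMr ?addr_gt0//; lra.
have r2 : 2 * p / (p + 2) < 2 by rewrite ltr_pdivrMr ?addr_gt0//; lra.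
have eps4 : 0 < eps / 4 by rewrite divr_gt0.
have seps4 : 0 < Num.sqrt (eps / 4) by rewrite sqrtr_gt0.
have [N1 H1] := uniform_marcinkiewicz_zygmund Xindep Xident
  (fun P _ => msq P) pp2 pp4 ui_sq eps4 eta2.
have [N2 H2] := uniform_marcinkiewicz_zygmund Xindep Xident
  (fun P _ => mdev P) r1 r2 ui_dev seps4 eta2.
exists (maxn 1 (maxn N1 N2)) => m; rewrite !geq_max => /and3P[m0 m1 m2].
apply: ge_ereal_sup => _ [P PPP <-].
have := H1 m m1 P PPP; have := H2 m m2 P PPP.
set B := [set w | exists2 k, _ & _]; set A := [set w | exists2 k, _ & _] => PB PA.
have mevent (h : R -> R) (e s u : R) : measurable_fun [set: R] h ->
    measurable [set w | exists2 k, (m <= k)%N & e * k%:R `^ s <=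
      `|\sum_(i < k) (h (X i w) - u)|].
  move=> mh; apply: measurable_some_large => k; apply: measurable_sum => i.
  by apply: measurable_funB => //; exact: measurableT_comp.
have mA : measurable A by exact: mevent.
have mB : measurable B by exact: mevent.
apply: (@le_trans _ _ (P (A `|` B))); last first.
  by rewrite (le_trans (measureU2 _ mA mB))// [eta]splitr EFinD leeD.
apply: le_measure; rewrite ?inE.
- exact: measurable_sample_variance_event.
- exact: measurableU.
move=> w /=; rewrite VE// => sup_ge.
have s0 : 0 < 2 / p by rewrite divr_gt0.
have [[k mk kS]|[k mk kS]] :=
    sample_variance_deviation (c P) m0 eps_gt0 s0 sup_ge.
  by left; exists k => //; rewrite invf_div.
right; exists k => //; rewrite dev0// invf_div.
rewrite [X in _ `^ X](_ : _ = (1 + 2 / p) / 2); last first.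
  by field; rewrite gt_eqF.
by under eq_bigr do rewrite subr0.
Qed.
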